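(* Let $\mathcal{I}$ be either $\mathcal{P}_\infty$ or $\mathcal{B}$. The isometry class $\{\mu\in\mathcal{I}: X_\mu$ is weakly octahedral$\}$ is $F_{\sigma\delta}$ in $\mathcal{I}$.
   Context: Coding: $V$ is the set of finitely supported rational sequences; $\mathcal{P}\subset\mathbb{R}^V$ the seminorms on $V$ with pointwise convergence topology; for $\mu\in\mathcal{P}$, $\bar\mu$ is its seminorm extension to $c_{00}$ and $X_\mu$ the completion of $c_{00}/\{\bar\mu=0\}$; $\mathcal{P}_\infty=\{\mu:\dim X_\mu=\infty\}$, $\mathcal{B}=\{\mu\in\mathcal{P}_\infty:\bar\mu$ a norm on $c_{00}\}$, subspace topologies. A Banach space $X$ is weakly octahedral (WOH) if for every finite-dimensional subspace $E\subset X$, every $f\in B_{X^*}$ and $\varepsilon>0$ there is $y\in S_X$ with $\|x+y\|\ge(1-\varepsilon)(|f(x)|+\|y\|)$ for all $x\in E$. *)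

(* Defs.v *)
From HB Require Import structures.
From mathcomp Require Import all_boot all_order all_algebra.
From mathcomp Require Import all_classical all_reals all_analysis.
Set Implicit Arguments. Unset Strict Implicit. Unset Printing Implicit Defensive.
Import Order.TTheory GRing.Theory Num.Theory.
Import numFieldTopology.Exports numFieldNormedType.Exports.
Local Open Scope ring_scope.
Local Open Scope classical_set_scope.

Definition V : Type :=
  {f : nat -> rat | exists N : nat, forall n : nat, (N <= n)%N -> f n = 0}.

Section Defs.
Variable R : realType.

Definition seminormV (mu : V -> R) : Prop :=
  (forall u : V, 0 <= mu u) /\
  (forall u v w : V, (forall n, sval w n = sval u n + sval v n) ->
     mu w <= mu u + mu v) /\
  (forall (q : rat) (u w : V), (forall n, sval w n = q * sval u n) ->
     mu w = `|ratr q| * mu u).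

Definition finsupp (x : nat -> R) : Prop :=
  exists N : nat, forall n : nat, (N <= n)%N -> x n = 0.

Definition approx_fun (k : nat) (x : nat -> R) (n : nat) : rat :=
  if (n < k)%N then ((Num.floor (k%:R * x n))%:~R / k%:R) else 0.

Lemma approx_fun_supp (k : nat) (x : nat -> R) :
  exists N : nat, forall n : nat, (N <= n)%N -> approx_fun k x n = 0.
Proof.
exists k => n Hn; rewrite /approx_fun.
by case: ltnP Hn => // H1 H2; exfalso; move: (leq_trans H2 H1); rewrite ltnn.
Qed.

Definition approx (k : nat) (x : nat -> R) : V :=
  exist _ (approx_fun k x) (approx_fun_supp k x).

(* mubar : the (unique, continuous) seminorm extension of mu to c00,
   obtained as a limit along rational approximations *)
Definition mubar (mu : V -> R) (x : nat -> R) : R :=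
  limn (fun k : nat => mu (approx k x)).

(* elements of X_mu are represented by mubar-Cauchy sequences in c00
   (X_mu = such sequences modulo null ones) *)
Definition isX (mu : V -> R) (s : nat -> nat -> R) : Prop :=
  (forall k, finsupp (s k)) /\
  (forall e : R, 0 < e -> exists K : nat, forall k l : nat,
     (K <= k)%N -> (K <= l)%N -> mubar mu (fun n => s k n - s l n) < e).

Definition xnorm (mu : V -> R) (s : nat -> nat -> R) : R :=
  limn (fun k : nat => mubar mu (s k)).

Definition isXdual (mu : V -> R) (f : (nat -> nat -> R) -> R) : Prop :=
  (forall s t, isX mu s -> isX mu t -> forall a b : R,
     f (fun k n => a * s k n + b * t k n) = a * f s + b * f t) /\
  (forall s, isX mu s -> `|f s| <= xnorm mu s).

(* X_mu is weakly octahedral: finite-dimensional subspaces E are the spans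
   of finite families e_0, ..., e_{m-1} *)
Definition WOH (mu : V -> R) : Prop :=
  forall (m : nat) (e : 'I_m -> nat -> nat -> R), (forall i, isX mu (e i)) ->
  forall f, isXdual mu f ->
  forall eps : R, 0 < eps ->
  exists y : nat -> nat -> R, isX mu y /\ xnorm mu y = 1 /\
    forall c : 'I_m -> R,
      let x := fun k n => \sum_(i < m) c i * e i k n in
      xnorm mu (fun k n => x k n + y k n) >= (1 - eps) * (`|f x| + xnorm mu y).

Definition infdim (mu : V -> R) : Prop :=
  forall m : nat, exists e : 'I_m -> nat -> nat -> R,
    (forall i, isX mu (e i)) /\
    forall c : 'I_m -> R,
      xnorm mu (fun k n => \sum_(i < m) c i * e i k n) = 0 -> forall i, c i = 0.

Definition RV := {ptws V -> R}.

Definition Pinf : set RV := [set mu : RV | seminormV mu /\ infdim mu].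

Definition Bset : set RV :=
  [set mu : RV | Pinf mu /\
     forall x : nat -> R, finsupp x -> mubar mu x = 0 -> forall n, x n = 0].

Definition Fsd_in (I S : set RV) : Prop :=
  exists C : nat -> nat -> set RV, (forall n m, closed (C n m)) /\
    S = I `&` \bigcap_(n in [set: nat]) \bigcup_(m in [set: nat]) C n m.

End Defs.

(* Main.v *)
Require Import Defs.
From HB Require Import structures.
From mathcomp Require Import all_boot all_order all_algebra.
From mathcomp Require Import all_classical all_reals all_analysis.
From mathcomp Require Import ring lra.
Set Implicit Arguments. Unset Strict Implicit. Unset Printing Implicit Defensive.
Import Order.TTheory GRing.Theory Num.Theory.
Import numFieldTopology.Exports numFieldNormedType.Exports.
Local Open Scope ring_scope.
Local Open Scope classical_set_scope.

(** By Hahn-Banach, the restrictions to a finite-dimensional subspace of the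
    functionals in the dual ball are exactly the functionals of norm at most 1 on
    that subspace.  Given rational vectors [v_1 .. v_m], rational values [a_1 .. a_m]
    and a rational tolerance, weak octahedrality thus requires that either
    [mu (sum c_i v_i) < |sum c_i a_i|] for some rational [c] (so that no functional
    in the ball takes the values [a]), or some rational [y] is almost octahedral with
    respect to [v] and [a].  Each alternative is a countable union of closed conditions
    on [mu].  Conversely these rational instances suffice: a functional on a linearly
    independent family can be shrunk slightly and then perturbed, together with the
    family, to rational data while its norm stays at most 1; and in a dependent family
    (with respect to the seminorm) some vector can be dropped. *)

(** * Extension of a seminorm from rational to real finitely supported sequences *)

Definition is_seminorm (R : realType) (E : lmodType R) (p : E -> R) : Prop :=
  (forall x y, p (x + y) <= p x + p y) /\ (forall a x, p (a *: x) = `|a| * p x).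

Section Seminorm.
Variables (R : realType) (E : lmodType R) (p : E -> R).
Hypothesis sp : is_seminorm p.

Lemma seminormD x y : p (x + y) <= p x + p y.
Proof. exact: sp.1. Qed.

Lemma seminormZ a x : p (a *: x) = `|a| * p x.
Proof. exact: sp.2. Qed.

Lemma seminorm0 : p 0 = 0.
Proof. by rewrite -(scale0r 0) seminormZ normr0 mul0r. Qed.

Lemma seminormN x : p (- x) = p x.
Proof. by rewrite -scaleN1r seminormZ normrN1 mul1r. Qed.

(** Subadditivity at [x] and [- x] gives [0 = p 0 <= 2 * p x]. *)
Lemma seminorm_ge0 x : 0 <= p x.
Proof.
have := seminormD x (- x); rewrite subrr seminorm0 seminormN -mulr2n.
by rewrite pmulrn_lge0.
Qed.

Lemma seminorm_distC x y : p (x - y) = p (y - x).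
Proof. by rewrite -seminormN opprB. Qed.

Lemma seminorm_dist x y : `|p x - p y| <= p (x - y).
Proof.
have h u v : p u - p v <= p (u - v) by rewrite lerBlDr -{1}(subrK v u) seminormD.
by rewrite ler_norml h andbT lerNl opprB seminorm_distC h.
Qed.

Lemma seminorm_sum (I : Type) (r : seq I) (F : I -> E) :
  p (\sum_(i <- r) F i) <= \sum_(i <- r) p (F i).
Proof.
elim/big_ind2 : _ => [|x x' y y' hx hy|//]; first by rewrite seminorm0.
exact: le_trans (seminormD _ _) (lerD hx hy).
Qed.

Lemma seminorm_bigZ (I : Type) (r : seq I) (c : I -> R) (F : I -> E) :
  p (\sum_(i <- r) c i *: F i) <= \sum_(i <- r) `|c i| * p (F i).
Proof.
apply: le_trans (seminorm_sum _ _) _.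
by apply: ler_sum => i _; rewrite seminormZ.
Qed.

End Seminorm.

Lemma cauchy_seq_cvg (R : realType) (u : nat -> R) :
  (forall e, 0 < e -> exists K : nat, forall k l, (K <= k)%N -> (K <= l)%N ->
     `|u k - u l| < e) -> cvgn u.
Proof.
move=> h; apply/cauchy_cvgP/cauchyP => e e0.
have [K hK] := h e e0; exists (u K); exists K => // k /= Kk.
by rewrite /ball /=; apply: hK.
Qed.

Lemma approx_rat (R : realType) (x e : R) : 0 < e -> exists q : rat, `|x - ratr q| < e.
Proof.
move=> e0; have /rat_in_itvoo[q] : x < x + e by rewrite ltrDl.
rewrite in_itv/= => /andP[xq qx]; exists q.
by rewrite distrC gtr0_norm ?subr_gt0// ltrBlDl.
Qed.

Section Extension.
Variables (R : realType) (mu : V -> R).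
Hypothesis smu : seminormV mu.

Lemma poly_finsupp (F : nzRingType) (q : {poly F}) :
  exists N : nat, forall n : nat, (N <= n)%N -> q`_n = 0.
Proof. by exists (size q) => n h; rewrite nth_default. Qed.

(* Polynomials stand for finitely supported sequences: [{poly rat}] for [V], countable
   as a type, and [{poly R}] for c00. *)
Definition polyV (v : {poly rat}) : V :=
  exist _ (fun n => v`_n) (poly_finsupp v).

Local Notation nu v := (mu (polyV v)).

Lemma muD u v : nu (u + v) <= nu u + nu v.
Proof. by apply: smu.2.1 => n; rewrite /= coefD. Qed.

Lemma muZ a v : nu (a *: v) = `|ratr a| * nu v.
Proof. by apply: smu.2.2 => n; rewrite /= coefZ. Qed.

Lemma mu_ext (u v : V) : sval u =1 sval v -> mu u = mu v.
Proof.
move=> h; rewrite (smu.2.2 1 v u) ?rmorph1 ?normr1 ?mul1r// => n.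
by rewrite mul1r h.
Qed.

(** A weighted l1 seminorm dominating [mu]. It makes sense for real coefficients at once, so
    rational approximation can be measured in it before [mu] has been extended. *)
Definition wnorm (q : {poly R}) : R := \sum_(i < size q) `|q`_i| * nu 'X^i.

Lemma wnorm_widen (q : {poly R}) N : (size q <= N)%N ->
  wnorm q = \sum_(i < N) `|q`_i| * nu 'X^i.
Proof.
move=> qN; rewrite /wnorm (big_ord_widen N (fun i => `|q`_i| * nu 'X^i) qN).
rewrite big_mkcond/=; apply: eq_bigr => i _; case: ifPn => // /negP/negP.
by rewrite -leqNgt => h; rewrite nth_default// normr0 mul0r.
Qed.

Lemma nu_ge0 v : 0 <= nu v. Proof. exact: smu.1. Qed.

Lemma wnorm_seminorm : is_seminorm (wnorm : {poly R} -> R).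
Proof.
split=> [q r|a q].
  set N := maxn (size q) (size r).
  rewrite !(@wnorm_widen _ N) ?leq_maxl ?leq_maxr ?size_polyD//.
  rewrite -big_split/=; apply: ler_sum => i _.
  by rewrite coefD -mulrDl ler_wpM2r ?ler_normD// nu_ge0.
rewrite !(@wnorm_widen _ (size q)) ?size_scale_leq// mulr_sumr.
by apply: eq_bigr => i _; rewrite coefZ normrM mulrA.
Qed.

Lemma mu_wnorm v : nu v <= wnorm (map_poly ratr v).
Proof.
rewrite (@wnorm_widen _ (size v)) ?size_map_poly//.
rewrite -[in leLHS](coefK v) poly_def.
elim/big_ind2 : _ => [|x x' y y' hx hy|i _].
- by rewrite -(scale0r 0) muZ rmorph0 normr0 mul0r.
- exact: le_trans (muD _ _) (lerD hx hy).
- by rewrite muZ coef_map.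
Qed.

Lemma mu_dist u v : `|nu u - nu v| <= wnorm (map_poly ratr (u - v)).
Proof.
have muN w : nu (- w) = nu w by rewrite -scaleN1r muZ rmorphN1 normrN1 mul1r.
have h u' v' : nu u' - nu v' <= nu (u' - v') by rewrite lerBlDr -{1}(subrK v' u') muD.
apply: le_trans (mu_wnorm _).
by rewrite ler_norml h andbT lerNl opprB -[leRHS]muN opprB h.
Qed.

Definition approxP k (q : {poly R}) : {poly rat} :=
  \poly_(i < k) Defs.approx_fun k (fun n => q`_n) i.

Lemma mu_approx k (q : {poly R}) : mu (Defs.approx k (fun n => q`_n)) = nu (approxP k q).
Proof.
apply: mu_ext => n; rewrite /= coef_poly /Defs.approx_fun.
by case: ifP => // ->.
Qed.

Lemma floor_approx k (x : R) : (0 < k)%N ->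
  `|x - ratr ((Num.floor (k%:R * x))%:~R / k%:R)| <= k%:R^-1.
Proof.
move=> k0; have kR : 0 < k%:R :> R by rewrite ltr0n.
rewrite fmorph_div rmorph_int rmorph_nat.
have -> : x - (Num.floor (k%:R * x))%:~R / k%:R =
   (k%:R * x - (Num.floor (k%:R * x))%:~R) / k%:R.
  by rewrite mulrBl mulrAC divff ?mul1r// gt_eqF.
have /andP[h1 h2] := floor_itv (k%:R * x).
rewrite ger0_norm; last by rewrite divr_ge0 ?subr_ge0 ?ler0n.
rewrite ler_pdivrMr// mulVf ?gt_eqF// lerBlDl ltW//.
by rewrite intrD in h2.
Qed.

Lemma wnorm_approxP (q : {poly R}) : exists M : R, 0 <= M /\
  forall k, (0 < k)%N -> (size q <= k)%N ->
  wnorm (q - map_poly ratr (approxP k q)) <= M / k%:R.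
Proof.
(* The sum of the weights of the degrees below [size q]; each coefficient is off by at most
   [1 / k]. *)
exists (\sum_(i < size q) nu 'X^i); split; first by apply: sumr_ge0 => i _; exact: nu_ge0.
move=> k k0 qk; rewrite (@wnorm_widen _ (size q)); last first.
  rewrite (leq_trans (size_polyD _ _))// geq_max leqnn size_polyN size_map_poly.
  (* Beyond the size of [q] the approximation vanishes too, as the floor of 0 is 0. *)
  apply/leq_sizeP => j qj; rewrite coef_poly /Defs.approx_fun; case: ifP => // ->.
  by rewrite nth_default// mulr0 floor0 mul0r.
rewrite mulr_suml; apply: ler_sum => i _.
rewrite mulrC ler_wpM2l ?nu_ge0// coefB coef_map coef_poly /Defs.approx_fun.
by rewrite (leq_trans (ltn_ord i) qk) floor_approx.
Qed.

Lemma wnorm_approxP_cvg0 (q : {poly R}) (e : R) : 0 < e -> exists K : nat,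
  forall k, (K <= k)%N -> wnorm (q - map_poly ratr (approxP k q)) < e.
Proof.
move=> e0; have [M [M0 h]] := wnorm_approxP q.
have M1 : 0 < M + 1 by rewrite ltr_wpDl.
have [K _ hK] := near_infty_natSinv_lt (PosNum (divr_gt0 e0 M1)).
(* [hK] bounds [1 / (k + 1)], whence the successor. *)
exists (maxn K (size q)).+1 => -[//|k]; rewrite ltnS geq_max => /andP[Kk qk].
apply: le_lt_trans (h _ _ _) _ => //; first exact: leqW.
have := hK k Kk; rewrite /= ltr_pdivlMr// mulrC => /le_lt_trans; apply.
by rewrite ler_wpM2r ?invr_ge0 ?ler0n// lerDl.
Qed.

Lemma wnorm_dense (q : {poly R}) (e : R) : 0 < e ->
  exists v, wnorm (q - map_poly ratr v) < e.
Proof. by move=> /(wnorm_approxP_cvg0 q)[K hK]; exists (approxP K q); exact: hK. Qed.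

Definition pbar (q : {poly R}) : R := mubar mu (fun n => q`_n).

Let sw := wnorm_seminorm.

Lemma pbarE q : pbar q = limn (fun k => nu (approxP k q)).
Proof.
rewrite /pbar /mubar; congr (limn _).
by apply/funext => k; rewrite mu_approx.
Qed.

Lemma is_cvg_nu_approxP q : cvgn (fun k => nu (approxP k q)).
Proof.
apply: cauchy_seq_cvg => e e0.
have [K hK] := wnorm_approxP_cvg0 q (divr_gt0 e0 (ltr0n _ 2)).
exists K => k l Kk Kl; apply: le_lt_trans (mu_dist _ _) _.
rewrite rmorphB/= -(subrKA q) addrC (splitr e).
apply: le_lt_trans (seminormD sw _ _) _; apply: ltrD; first exact: hK.
by rewrite seminorm_distC//; exact: hK.
Qed.

(** The bound [mu_dist] passes to the limit along [approxP k q]. The seminorm properties of [pbar]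
    then follow by replacing real polynomials with nearby rational ones. *)
Lemma pbar_mu_dist q v : `|pbar q - nu v| <= wnorm (q - map_poly ratr v).
Proof.
apply/ler_addgt0Pr => e e0.
have [K hK] := wnorm_approxP_cvg0 q e0.
rewrite pbarE.
have cv : `|nu (approxP k q) - nu v| @[k --> \oo] -->
    `|limn (fun k => nu (approxP k q)) - nu v|.
  by apply: cvg_norm; apply: cvgB; [exact: is_cvg_nu_approxP|exact: cvg_cst].
rewrite -(cvg_lim _ cv)//; apply: limr_le; first by apply/cvg_ex; eexists; exact: cv.
exists K => // k /= Kk; apply: le_trans (mu_dist _ _) _.
rewrite rmorphB/= -(subrKA q) addrC.
apply: le_trans (seminormD sw _ _) _; rewrite lerD2l seminorm_distC//.
exact/ltW/hK.
Qed.

Lemma pbar_mu v : pbar (map_poly ratr v) = nu v.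
Proof.
apply/eqP; rewrite -subr_eq0 -normr_le0; apply: le_trans (pbar_mu_dist _ _) _.
by rewrite subrr (seminorm0 sw).
Qed.

Lemma pbar_le_wnorm q : pbar q <= wnorm q.
Proof.
have := pbar_mu_dist q 0; rewrite rmorph0 subr0 => h.
have -> : pbar q = pbar q - nu 0 by rewrite -(scale0r 0) muZ rmorph0 normr0 mul0r subr0.
exact: le_trans (ler_norm _) h.
Qed.

Lemma pbarD q r : pbar (q + r) <= pbar q + pbar r.
Proof.
apply/ler_addgt0Pr => e e0; have e4 := divr_gt0 e0 (ltr0n _ 4).
have [u hu] := wnorm_dense q e4; have [v hv] := wnorm_dense r e4.
have h1 := pbar_mu_dist q u; have h2 := pbar_mu_dist r v.
have h3 := pbar_mu_dist (q + r) (u + v).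
have h4 := muD u v.
have h5 : wnorm (q + r - map_poly ratr (u + v)) <=
    wnorm (q - map_poly ratr u) + wnorm (r - map_poly ratr v).
  by rewrite rmorphD opprD addrACA; exact: seminormD.
move: h1 h2 h3; rewrite !ler_norml => /andP[? ?] /andP[? ?] /andP[? ?]; lra.
Qed.

Lemma pbar_ge0 q : 0 <= pbar q.
Proof.
apply/ler_addgt0Pr => e e0.
have [u hu] := wnorm_dense q e0; have h1 := pbar_mu_dist q u.
by move: h1 (nu_ge0 u); rewrite !ler_norml => /andP[? ?] ?; lra.
Qed.

Lemma pbar_ratrZ a q : pbar (ratr a *: q) = `|ratr a| * pbar q.
Proof.
apply/eqP; rewrite -subr_eq0 -normr_le0; apply/ler_addgt0Pr => e e0.
set b : R := `|ratr a|; have b0 : 0 <= b by exact: normr_ge0.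
have e1 : 0 < e / (2 * (b + 1)) by apply: divr_gt0 => //; lra.
have [u hu] := wnorm_dense q e1; have h1 := pbar_mu_dist q u.
have h2 := pbar_mu_dist (ratr a *: q) (a *: u).
have e3 : map_poly ratr (a *: u) = ratr a *: map_poly ratr u :> {poly R}.
  by apply/polyP => i; rewrite coefZ !coef_map/= coefZ rmorphM.
move: h2; rewrite e3 -scalerBr (seminormZ sw) muZ -/b => h2.
have -> : pbar (ratr a *: q) - b * pbar q =
    (pbar (ratr a *: q) - b * nu u) - b * (pbar q - nu u) by ring.
apply: le_trans (ler_normB _ _) _; rewrite normrM (ger0_norm b0) add0r.
have h6 : b * wnorm (q - map_poly ratr u) <= e / 2.
  rewrite ltr_pdivlMr in hu; last lra.
  by have := seminorm_ge0 sw (q - map_poly ratr u); nra.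
have h7 := ler_wpM2l b0 h1.
lra.
Qed.

(** For homogeneity, take a rational [b] near the real scalar [a]: [pbar (a *: q) - pbar (b *: q)]
    and [(|a| - |b|) * pbar q] are both at most [|a - b| * wnorm q] in absolute value, and rational
    scalars are already settled. *)
Lemma pbar_seminorm : is_seminorm pbar.
Proof.
split; first exact: pbarD.
move=> a q; apply/eqP; rewrite -subr_eq0 -normr_le0; apply/ler_addgt0Pr => e e0.
set w := wnorm q; have w0 : 0 <= w by exact: seminorm_ge0.
have e1 : 0 < e / (2 * (w + 1)) by apply: divr_gt0 => //; lra.
have [b0 hb] := approx_rat a e1.
have := pbar_ratrZ b0 q; set b := ratr b0 in hb * => hZ; clearbody b.
have pN r : pbar (- r) = pbar r.
  by rewrite -scaleN1r -(rmorphN1 ratr) pbar_ratrZ rmorphN1 normrN1 mul1r.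
have hd r s : `|pbar r - pbar s| <= pbar (r - s).
  have h r' s' : pbar r' - pbar s' <= pbar (r' - s') by rewrite lerBlDr -{1}(subrK s' r') pbarD.
  by rewrite ler_norml h andbT lerNl opprB -[leRHS]pN opprB h.
have := hd (a *: q) (b *: q); rewrite -scalerBl hZ => h1.
have h2 := pbar_le_wnorm ((a - b) *: q); rewrite (seminormZ sw) -/w in h2.
have h3 := pbar_le_wnorm q; rewrite -/w in h3.
have h4 := pbar_ge0 q.
have h5 := ler_dist_dist a (b).
rewrite ltr_pdivlMr in hb; last lra.
have -> : pbar (a *: q) - `|a| * pbar q =
    (pbar (a *: q) - `|b| * pbar q) - (`|a| - `|b|) * pbar q by ring.
apply: le_trans (ler_normB _ _) _; rewrite normrM (ger0_norm h4) add0r.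
have h6 : `| `|a| - `|b| | * pbar q <= `|a - b| * w by apply: ler_pM.
have := normr_ge0 (a - b); nra.
Qed.

Lemma pbar_dense (q : {poly R}) (e : R) : 0 < e ->
  exists v : {poly rat}, pbar (q - map_poly ratr v) < e.
Proof.
move=> /(wnorm_dense q)[v hv]; exists v.
exact: le_lt_trans (pbar_le_wnorm _) hv.
Qed.

End Extension.

(** * The completion and its dual ball *)

Definition pcauchy (R : realType) (E : lmodType R) (p : E -> R) (S : nat -> E) :=
  forall e, 0 < e -> exists K : nat, forall k l, (K <= k)%N -> (K <= l)%N ->
    p (S k - S l) < e.

Lemma cvgn_mull (R : realType) (a : R) (u : nat -> R) : cvgn u ->
  (fun k => a * u k) @ \oo --> a * limn u.
Proof. by move=> cu; apply: cvgM => //; exact: cvg_cst. Qed.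

Section Pcauchy.
Variables (R : realType) (E : lmodType R) (p : E -> R).
Hypothesis sp : is_seminorm p.

Lemma is_cvg_pcauchy S : pcauchy p S -> cvgn (p \o S).
Proof.
move=> cS; apply: cauchy_seq_cvg => e /cS[K hK]; exists K => k l Kk Kl.
exact: le_lt_trans (seminorm_dist sp _ _) (hK _ _ Kk Kl).
Qed.

Lemma is_cvg_linear_pcauchy (G : E -> R) S : (forall x y, G (x - y) = G x - G y) ->
  (forall x, `|G x| <= p x) -> pcauchy p S -> cvgn (G \o S).
Proof.
move=> GB Gp cS; apply: cauchy_seq_cvg => e /cS[K hK]; exists K => k l Kk Kl.
by rewrite /= -GB; apply: le_lt_trans (Gp _) (hK _ _ Kk Kl).
Qed.

Lemma pcauchy_cst x : pcauchy p (fun=> x).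
Proof. by move=> e e0; exists 0 => k l _ _; rewrite subrr (seminorm0 sp). Qed.

Lemma pcauchyD S T : pcauchy p S -> pcauchy p T -> pcauchy p (fun k => S k + T k).
Proof.
move=> cS cT e e0; have e2 := divr_gt0 e0 (ltr0n _ 2).
have [K hK] := cS _ e2; have [L hL] := cT _ e2.
exists (maxn K L) => k l; rewrite !geq_max => /andP[Kk Lk] /andP[Kl Ll].
rewrite opprD addrACA (splitr e); apply: le_lt_trans (seminormD sp _ _) _.
by apply: ltrD; [exact: hK|exact: hL].
Qed.

Lemma pcauchyZ a S : pcauchy p S -> pcauchy p (fun k => a *: S k).
Proof.
move=> cS e e0; have a1 : 0 < `|a| + 1 by rewrite ltr_wpDl.
have [K hK] := cS _ (divr_gt0 e0 a1); exists K => k l Kk Kl.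
rewrite -scalerBr (seminormZ sp); have := hK k l Kk Kl.
rewrite ltr_pdivlMr// mulrC => /le_lt_trans; apply.
by rewrite ler_wpM2r ?(seminorm_ge0 sp)// lerDl.
Qed.

End Pcauchy.

Section Completion.
Variables (R : realType) (mu : V -> R).
Hypothesis smu : seminormV mu.

Let p : {poly R} -> R := pbar mu.
Let sp : is_seminorm p := pbar_seminorm smu.

(** The form in which [isX] sees a sequence of polynomials; by [isX_ex] every element of the
    completion has it. *)
Definition coefs (S : nat -> {poly R}) : nat -> nat -> R := fun k n => (S k)`_n.

Lemma finsupp_poly (x : nat -> R) : finsupp x -> exists q : {poly R}, x = fun n => q`_n.
Proof.
move=> [N hN]; exists (\poly_(i < N) x i); apply/funext => n.
by rewrite coef_poly; case: ltnP => // /hN.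
Qed.

Lemma isX_coefs S : isX mu (coefs S) <-> pcauchy p S.
Proof.
have E k l : mubar mu (fun n => coefs S k n - coefs S l n) = p (S k - S l).
  by rewrite /p /pbar; congr mubar; apply/funext => n; rewrite coefB.
split=> [[_ h] e /h[K hK]|h]; last split=> [k|e /h[K hK]].
- by exists K => k l Kk Kl; rewrite -E; exact: hK.
- exact: poly_finsupp.
- by exists K => k l Kk Kl; rewrite E; exact: hK.
Qed.

Lemma isX_ex s : isX mu s -> exists2 S, s = coefs S & pcauchy p S.
Proof.
move=> Xs; have [S hS] := choice (fun k => finsupp_poly (Xs.1 k)).
have E : s = coefs S by apply/funext => k; rewrite hS.
by exists S => //; apply/isX_coefs; rewrite -E.
Qed.

Lemma coefsD S T : coefs S + coefs T = coefs (fun k => S k + T k).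
Proof. by apply/funext => k; apply/funext => n; rewrite /coefs coefD. Qed.

Lemma coefsZ a S : a *: coefs S = coefs (fun k => a *: S k).
Proof. by apply/funext => k; apply/funext => n; rewrite /coefs coefZ. Qed.

Lemma isXD s t : isX mu s -> isX mu t -> isX mu (s + t).
Proof.
move=> /isX_ex[S -> cS] /isX_ex[T -> cT]; rewrite coefsD.
by apply/isX_coefs; exact: pcauchyD.
Qed.

Lemma isXZ a s : isX mu s -> isX mu (a *: s).
Proof.
by move=> /isX_ex[S -> cS]; rewrite coefsZ; apply/isX_coefs; exact: pcauchyZ.
Qed.

Lemma isXB s t : isX mu s -> isX mu t -> isX mu (s - t).
Proof. by move=> Xs Xt; rewrite -scaleN1r; apply: isXD => //; exact: isXZ. Qed.

Lemma is_cvg_xnorm s : isX mu s -> cvgn (fun k => mubar mu (s k)).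
Proof. by move=> /isX_ex[S -> cS]; exact: (is_cvg_pcauchy sp cS). Qed.

Lemma xnormD s t : isX mu s -> isX mu t -> xnorm mu (s + t) <= xnorm mu s + xnorm mu t.
Proof.
move=> Xs Xt; have Xst := isXD Xs Xt; rewrite /xnorm.
rewrite -limD; [|exact: is_cvg_xnorm..].
apply: ler_lim; [exact: is_cvg_xnorm|apply: is_cvgD; exact: is_cvg_xnorm|].
move: Xs Xt {Xst} => /isX_ex[S -> _] /isX_ex[T -> _]; rewrite coefsD.
by apply: nearW => k; exact: (seminormD sp).
Qed.

Lemma xnormZ a s : isX mu s -> xnorm mu (a *: s) = `|a| * xnorm mu s.
Proof.
move=> Xs; rewrite /xnorm -(cvg_lim _ (cvgn_mull (is_cvg_xnorm Xs)))//.
congr (limn _); apply/funext => k; move: Xs => /isX_ex[S -> _].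
by rewrite coefsZ; exact: (seminormZ sp).
Qed.

Lemma xnorm_ge0 s : isX mu s -> 0 <= xnorm mu s.
Proof.
move=> Xs; apply: limr_ge; first exact: is_cvg_xnorm.
by move: Xs => /isX_ex[S -> _]; apply: nearW => k; exact: (seminorm_ge0 sp).
Qed.

(** The canonical map from c00 to the completion. *)
Definition cstX (q : {poly R}) : nat -> nat -> R := coefs (fun=> q).

Lemma isX_cst q : isX mu (cstX q).
Proof. by apply/isX_coefs; exact: pcauchy_cst. Qed.

Lemma xnorm_cst q : xnorm mu (cstX q) = p q.
Proof. by transitivity (limn (fun=> p q)) => //; rewrite lim_cst. Qed.

Lemma isX0 : isX mu 0.
Proof. by rewrite -(scale0r (cstX 0)); apply: isXZ; exact: isX_cst. Qed.

Lemma isX_sum m (c : 'I_m -> R) (e : 'I_m -> nat -> nat -> R) :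
  (forall i, isX mu (e i)) -> isX mu (\sum_(i < m) c i *: e i).
Proof.
by move=> Xe; apply: (big_ind (isX mu)) => [|s t|i _]; [exact: isX0|exact: isXD|exact: isXZ].
Qed.

Lemma cstX_sum m (c : 'I_m -> R) (v : 'I_m -> {poly R}) :
  cstX (\sum_(i < m) c i *: v i) = \sum_(i < m) c i *: cstX (v i).
Proof.
have D x y : cstX (x + y) = cstX x + cstX y by rewrite /cstX coefsD.
have Z a x : cstX (a *: x) = a *: cstX x by rewrite /cstX coefsZ.
apply: (big_ind2 (fun x y => cstX x = y)) => [|x x' y y' <- <-|i _]; last exact: Z.
  by rewrite -(scale0r 0) Z scale0r.
by rewrite D.
Qed.

Lemma cstXD q r : cstX (q + r) = cstX q + cstX r.
Proof. by rewrite /cstX coefsD. Qed.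

(** A late term of the Cauchy sequence is close to [s], and a rational polynomial is close to that
    term. *)
Lemma xnorm_dense s (e : R) : isX mu s -> 0 < e ->
  exists v : {poly rat}, xnorm mu (s - cstX (map_poly ratr v)) < e.
Proof.
move=> Xs e0; have [S sE cS] := isX_ex Xs.
have e3 : 0 < e / 3 by rewrite divr_gt0.
have [K hK] := cS _ e3; have [v hv] := pbar_dense smu (S K) e3.
(* Limits preserve only weak inequalities, so two thirds of [e] are spent and the rest gives
   strictness. *)
exists v; apply: (@le_lt_trans _ _ (e / 3 + e / 3)); last lra.
have Xv := isX_cst (map_poly ratr v).
apply: limr_le; first exact: is_cvg_xnorm (isXB Xs Xv).
exists K => // k /= Kk.
have -> : mubar mu ((s - cstX (map_poly ratr v)) k) = p (S k - map_poly ratr v).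
  by rewrite sE /p /pbar; congr mubar; apply/funext => n; rewrite coefB.
rewrite -(subrKA (S K)) ; apply: le_trans (seminormD sp _ _) _.
by apply: lerD; apply/ltW; [exact: hK|exact: hv].
Qed.

Lemma xnorm_sum m (c : 'I_m -> R) (e : 'I_m -> nat -> nat -> R) :
  (forall i, isX mu (e i)) ->
  xnorm mu (\sum_(i < m) c i *: e i) <= \sum_(i < m) `|c i| * xnorm mu (e i).
Proof.
(* Membership in the completion is carried through the induction because [xnormD] requires it. *)
move=> Xe; apply: (@proj2 (isX mu (\sum_(i < m) c i *: e i))).
apply: (big_ind2 (fun x y => isX mu x /\ xnorm mu x <= y)) => [|x x' y y' [Xx hx] [Xy hy]|i _].
- by split; [exact: isX0|rewrite -(scale0r (cstX 0)) xnormZ ?normr0 ?mul0r//; exact: isX_cst].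
- by split; [exact: isXD|exact: le_trans (xnormD Xx Xy) (lerD hx hy)].
- by split; [exact: isXZ|rewrite xnormZ].
Qed.

Lemma sum_funE m (c : 'I_m -> R) (e : 'I_m -> nat -> nat -> R) :
  (fun k n => \sum_(i < m) c i * e i k n) = \sum_(i < m) c i *: e i.
Proof.
apply/funext => k; apply/funext => n.
by rewrite fct_sumE fct_sumE.
Qed.

Lemma dual_lin f s t a b : isXdual mu f -> isX mu s -> isX mu t ->
  f (a *: s + b *: t) = a * f s + b * f t.
Proof. by move=> df Xs Xt; exact: df.1. Qed.

Lemma dual_sum f m (c : 'I_m -> R) (e : 'I_m -> nat -> nat -> R) :
  isXdual mu f -> (forall i, isX mu (e i)) ->
  f (\sum_(i < m) c i *: e i) = \sum_(i < m) c i * f (e i).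
Proof.
move=> df Xe.
have f0 : f 0 = 0 by have := dual_lin 0 0 df isX0 isX0; rewrite !scale0r !mul0r !addr0.
apply: (@proj2 (isX mu (\sum_(i < m) c i *: e i))).
apply: (big_ind2 (fun x y => isX mu x /\ f x = y)) => [|x x' y y' [Xx hx] [Xy hy]|i _].
- by split; [exact: isX0|].
- split; [exact: isXD|have := dual_lin 1 1 df Xx Xy].
  by rewrite !scale1r !mul1r hx hy.
- split; [exact: isXZ|have := dual_lin (c i) 0 df (Xe i) isX0].
  by rewrite scale0r mul0r !addr0.
Qed.

(** Inverse, by choice, of the coefficient map; sequences of infinite support get the default 0. *)
Definition poly_of (x : nat -> R) : {poly R} := xget 0 [set q : {poly R} | x = fun n => q`_n].

Lemma poly_ofK (q : {poly R}) : poly_of (fun n => q`_n) = q.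
Proof.
rewrite /poly_of; case: xgetP => [r _ /= E|/(_ q) []//].
by apply/polyP => n; rewrite -[RHS]/((fun n => q`_n) n) E.
Qed.

(** Applied to [x] and [- x], the bound gives [|G| <= p]. Hence [G] sends Cauchy sequences to
    convergent ones, and the limit defines the extension. *)
Lemma dual_extension (G : {poly R} -> R) :
  (forall a b x y, G (a *: x + b *: y) = a * G x + b * G y) ->
  (forall x, G x <= p x) ->
  exists2 f, isXdual mu f & forall q, f (cstX q) = G q.
Proof.
move=> Glin Gle.
have GB x y : G (x - y) = G x - G y.
  by have := Glin 1 (-1) x y; rewrite scale1r scaleN1r mul1r mulN1r.
have GN x : G (- x) = - G x.
  by have := Glin (-1) 0 x 0; rewrite scaleN1r scale0r mulN1r mul0r !addr0.
have Gp x : `|G x| <= p x.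
  by rewrite ler_norml Gle andbT lerNl -GN -(seminormN sp) Gle.
pose f (s : nat -> nat -> R) := limn (fun k => G (poly_of (s k))).
have fE S : f (coefs S) = limn (G \o S).
  by rewrite /f; congr (limn _); apply/funext => k; rewrite /coefs poly_ofK.
exists f; last by move=> q; rewrite fE; transitivity (limn (fun=> G q)) => //; rewrite lim_cst.
split=> [s t /isX_ex[S -> cS] /isX_ex[T -> cT] a b|s /isX_ex[S -> cS]].
  rewrite -[X in f X]/(a *: coefs S + b *: coefs T) !coefsZ coefsD !fE.
  have cGS := is_cvg_linear_pcauchy GB Gp cS.
  have cGT := is_cvg_linear_pcauchy GB Gp cT.
  have cG := cvgD (@cvgn_mull _ a _ cGS) (@cvgn_mull _ b _ cGT).
  by rewrite -(cvg_lim _ (cG _))//; congr (limn _); apply/funext => k; exact: Glin.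
rewrite fE -lim_norm; last exact: is_cvg_linear_pcauchy GB Gp cS.
apply: ler_lim; last by apply: nearW => k; exact: Gp.
  by apply: is_cvg_norm; exact: is_cvg_linear_pcauchy GB Gp cS.
exact: (is_cvg_pcauchy sp cS).
Qed.

End Completion.

(** * Hahn-Banach for finitely supported sequences *)

Section HahnBanach.
Variables (R : realType) (E : lmodType R).

(** Homogeneity is asked for nonnegative scalars only: [shift] can destroy the symmetry of a
    seminorm. *)
Definition sublinear (p : E -> R) : Prop :=
  (forall x y, p (x + y) <= p x + p y) /\
  (forall a x, 0 <= a -> p (a *: x) = a * p x).

Lemma sublinear0 p : sublinear p -> p 0 = 0.
Proof. by move=> sp; rewrite -(scale0r 0) sp.2// mul0r. Qed.

(* A linear functional dominated by [shift p K] is dominated by [p] and is at least [al]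
   at [u] for every [(u, al)] in [K]. *)
Definition shift (p : E -> R) (K : E -> R -> Prop) (x : E) : R :=
  inf [set r | exists u al, K u al /\ r = p (x + u) - al].

Definition convex_cone (K : E -> R -> Prop) : Prop :=
  [/\ K 0 0, forall u v al be, K u al -> K v be -> K (u + v) (al + be) &
      forall a u al, 0 < a -> K u al -> K (a *: u) (a * al)].

Section Shift.
Variables (p : E -> R) (K : E -> R -> Prop).
Hypotheses (sp : sublinear p) (cK : convex_cone K)
  (Kp : forall u al, K u al -> al <= p u).

Lemma shift_le x u al : K u al -> shift p K x <= p (x + u) - al.
Proof.
move=> Kual; apply: inf_lbound; last by exists u, al.
(* The set is bounded below since [be <= p v <= p (- x) + p (x + v)]. *)
exists (- p (- x)) => _ [v [be [/Kp Kv ->]]].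
have := sp.1 (- x) (x + v); rewrite addrA addNr add0r; lra.
Qed.

Lemma shift_ge x r : (forall u al, K u al -> r <= p (x + u) - al) -> r <= shift p K x.
Proof.
move=> h; apply: lb_le_inf; last by move=> _ [u [al [Ku ->]]]; exact: h.
by exists (p (x + 0) - 0), 0, 0; split=> //; case: cK.
Qed.

Lemma shift_le_self x : shift p K x <= p x.
Proof.
have [K0 _ _] := cK.
by apply: le_trans (shift_le x K0) _; rewrite addr0 subr0.
Qed.

(** The constraint [(u, al)] itself bounds the infimum at [- u]. A linear functional below the shift
    is therefore at least [al] at [u]. *)
Lemma shiftN u al : K u al -> shift p K (- u) <= - al.
Proof. by move=> /(shift_le (- u)); rewrite addNr sublinear0// sub0r. Qed.

(** Constraints for [x] and [y] add up to one for [x + y]. For [a > 0] one inequality is proved by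
    rescaling constraints; its instance at [a^-1] is the reverse one. *)
Lemma shift_sublinear : sublinear (shift p K).
Proof.
have [K0 KD KZ] := cK.
have Zle a x : 0 < a -> shift p K (a *: x) <= a * shift p K x.
  move=> a0; rewrite mulrC -ler_pdivrMr//; apply: shift_ge => u al Ku.
  rewrite ler_pdivrMr//; apply: le_trans (shift_le _ (KZ _ _ _ a0 Ku)) _.
  by rewrite [leRHS]mulrC mulrBr -scalerDr sp.2 // ltW.
split=> [x y|a x].
  rewrite -lerBlDr; apply: shift_ge => u al Ku.
  rewrite lerBlDr -lerBlDl; apply: shift_ge => v be Kv.
  have := shift_le (x + y) (KD _ _ _ _ Ku Kv).
  by have := sp.1 (x + u) (y + v); rewrite addrACA; lra.
rewrite le_eqVlt => /predU1P[<-|a0].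
  rewrite scale0r mul0r; apply/eqP; rewrite eq_le; apply/andP; split.
    by apply: le_trans (shift_le_self _) _; rewrite sublinear0.
  by apply: shift_ge => u al /Kp; rewrite add0r subr_ge0.
apply/eqP; rewrite eq_le Zle//= mulrC -ler_pdivlMr//.
rewrite -{1}(scale1r x) -(mulVf (lt0r_neq0 a0)) -scalerA mulrC.
by apply: Zle; rewrite invr_gt0.
Qed.

End Shift.

(** The constraints generated by asking for at least [p u] at [u]; together with domination by [p]
    they fix the value at [u]. *)
Definition ray (p : E -> R) (u w : E) (al : R) : Prop :=
  exists t, [/\ 0 <= t, w = t *: u & al = t * p u].

Lemma ray_cone p u : convex_cone (ray p u).
Proof.
split=> [|_ _ _ _ [s [s0 -> ->]] [t [t0 -> ->]]|a _ _ a0 [t [t0 -> ->]]].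
- by exists 0; rewrite scale0r mul0r.
- by exists (s + t); rewrite scalerDl mulrDl addr_ge0.
- by exists (a * t); rewrite scalerA mulrA mulr_ge0// ltW.
Qed.

Lemma ray_le p u : sublinear p -> forall w al, ray p u w al -> al <= p w.
Proof. by move=> sp _ _ [t [t0 -> ->]]; rewrite sp.2. Qed.

End HahnBanach.

Section PolyHahnBanach.
Variables (R : realType) (p : {poly R} -> R).
Hypothesis sp : sublinear p.

(** The values at the monomials are fixed one by one: stage [n + 1] imposes at ['X^n] the value that
    stage [n] takes there. As the monomials form a countable basis, this recursion stands in for
    Zorn's lemma. *)
Fixpoint hb_seq n : {poly R} -> R :=
  if n is n'.+1 then shift (hb_seq n') (ray (hb_seq n') 'X^n') else p.

Lemma hb_seq_sublinear n : sublinear (hb_seq n).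
Proof.
by elim: n => //= n IH; apply: shift_sublinear => //; [exact: ray_cone|exact: ray_le].
Qed.

Lemma hb_seq_le m n q : (m <= n)%N -> hb_seq n q <= hb_seq m q.
Proof.
move=> /subnK <-; elim: (n - m)%N => // k IH; rewrite addSn /=.
apply: le_trans IH; apply: shift_le_self (hb_seq_sublinear _) _ _ _.
  exact: ray_cone.
exact/ray_le/hb_seq_sublinear.
Qed.

(** The constraint at ['X^m] enters at stage [m + 1] and persists, because later stages only
    decrease. *)
Lemma hb_seqN m n : (m < n)%N -> hb_seq n (- 'X^m) <= - hb_seq m 'X^m.
Proof.
move=> mn; apply: le_trans (hb_seq_le _ mn) _ => /=.
apply: shiftN.
- exact: hb_seq_sublinear.
- exact/ray_le/hb_seq_sublinear.
by exists 1; rewrite scale1r mul1r.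
Qed.

Definition hb_fun (q : {poly R}) : R := \sum_(i < size q) q`_i * hb_seq i 'X^i.

Lemma hb_fun_widen (q : {poly R}) N : (size q <= N)%N ->
  hb_fun q = \sum_(i < N) q`_i * hb_seq i 'X^i.
Proof.
move=> qN; rewrite /hb_fun (big_ord_widen N (fun i => q`_i * hb_seq i 'X^i) qN).
rewrite big_mkcond/=; apply: eq_bigr => i _; case: ifPn => //.
by rewrite -leqNgt => h; rewrite nth_default// mul0r.
Qed.

Lemma hb_fun_linear a b x y : hb_fun (a *: x + b *: y) = a * hb_fun x + b * hb_fun y.
Proof.
set N := maxn (size x) (size y).
have sx c : (size (c *: x) <= N)%N by rewrite (leq_trans (size_scale_leq _ _))// leq_maxl.
have sy c : (size (c *: y) <= N)%N by rewrite (leq_trans (size_scale_leq _ _))// leq_maxr.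
rewrite !(@hb_fun_widen _ N) ?leq_maxl ?leq_maxr//; last first.
  by rewrite (leq_trans (size_polyD _ _))// geq_max sx sy.
rewrite !mulr_sumr -big_split/=; apply: eq_bigr => i _.
by rewrite coefD !coefZ mulrDl !mulrA.
Qed.

(** At stage [N = size q] all relevant values are fixed. Bounding [- q] term by term, with [hb_seqN]
    for nonnegative coefficients and monotonicity in the stage for negative ones, gives
    [hb_seq N (- q) <= - hb_fun q]; subadditivity at [q] and [- q] concludes. *)
Lemma hb_fun_le q : hb_fun q <= p q.
Proof.
set N := size q; have [DN ZN] := hb_seq_sublinear N.
apply: le_trans (hb_seq_le q (leq0n N)).
have : hb_seq N (- q) <= - hb_fun q.
  rewrite -{1}(coefK q) poly_def -sumrN /hb_fun -sumrN -/N.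
  apply: (big_ind2 (fun x y => hb_seq N x <= y)) => [|x x' y y' hx hy|i _].
  - by rewrite (sublinear0 (hb_seq_sublinear N)).
  - exact: le_trans (DN _ _) (lerD hx hy).
  case: (leP 0 q`_i) => hi.
    by rewrite -scalerN ZN// -mulrN; apply: ler_wpM2l => //; exact: hb_seqN.
  have hi' : 0 <= - q`_i by rewrite oppr_ge0 ltW.
  by rewrite -scaleNr -mulNr ZN//; apply: ler_wpM2l => //; apply/hb_seq_le/ltnW.
have := DN q (- q); rewrite subrr (sublinear0 (hb_seq_sublinear N)); lra.
Qed.

End PolyHahnBanach.

(** The prescribed values form a cone [K] of constraints, compatible with [p] by hypothesis. A
    linear functional below [shift p K] respects them, and as [K] contains opposite constraints it
    takes exactly the values [a]. *)
Lemma hahn_banach_poly (R : realType) (p : {poly R} -> R) m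
    (v : 'I_m -> {poly R}) (a : 'I_m -> R) : is_seminorm p ->
  (forall c : 'I_m -> R, \sum_(i < m) c i * a i <= p (\sum_(i < m) c i *: v i)) ->
  exists G : {poly R} -> R,
    [/\ forall s t x y, G (s *: x + t *: y) = s * G x + t * G y,
        forall x, G x <= p x & forall i, G (v i) = a i].
Proof.
move=> sp hva.
have subp : sublinear p by split; [exact: sp.1|move=> s x s0; rewrite sp.2 ger0_norm].
pose K (u : {poly R}) (al : R) := exists c : 'I_m -> R,
  u = \sum_(i < m) c i *: v i /\ al = \sum_(i < m) c i * a i.
have cK : convex_cone K.
  split=> [|_ _ _ _ [c [-> ->]] [d [-> ->]]|s _ _ s0 [c [-> ->]]].
  - by exists (fun=> 0); split; rewrite big1// => i _; rewrite ?scale0r ?mul0r.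
  - exists (fun i => c i + d i); rewrite -!big_split/=.
    by split; apply: eq_bigr => i _; rewrite ?scalerDl ?mulrDl.
  - exists (fun i => s * c i); rewrite scaler_sumr mulr_sumr.
    by split; apply: eq_bigr => i _; rewrite ?scalerA ?mulrA.
have Kp u al : K u al -> al <= p u by move=> [c [-> ->]].
have sq := shift_sublinear subp cK Kp.
exists (hb_fun (shift p K)); split=> [s t x y|x|i].
- exact: hb_fun_linear.
- by apply: le_trans (hb_fun_le sq _) _; exact: shift_le_self.
(* Here [t] may be negative; [t = 1] and [t = -1] give the two inequalities at the end. *)
have Kv t : K (t *: v i) (t * a i).
  exists (fun j => if j == i then t else 0); split.
    by rewrite (bigD1 i)//= eqxx big1 ?addr0// => j /negPf ->; rewrite scale0r.
  by rewrite (bigD1 i)//= eqxx big1 ?addr0// => j /negPf ->; rewrite mul0r.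
have hZ t : hb_fun (shift p K) (t *: v i) = t * hb_fun (shift p K) (v i).
  by have := hb_fun_linear (shift p K) t 0 (v i) 0; rewrite scale0r mul0r !addr0.
have h t : - t * hb_fun (shift p K) (v i) <= - (t * a i).
  rewrite -hZ scaleNr; apply: le_trans (hb_fun_le sq _) _.
  exact: (shiftN subp Kp (Kv t)).
by apply/eqP; rewrite eq_le; apply/andP; split; have := h 1; have := h (-1); lra.
Qed.

(** * Seminorms on row vectors *)

Section RowVectors.
Variables (R : realType) (m : nat).
Implicit Types (g : 'rV[R]_m -> R) (c : 'rV[R]_m).

Lemma rV_coef_le c i : `|c 0 i| <= `|c|.
Proof.
rewrite [leRHS]mx_normrE.
exact: (le_bigmax _ (fun ij : 'I_1 * 'I_m => `|c ij.1 ij.2|) (0, i)).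
Qed.

Lemma rV_norm_lt c (e : R) : 0 < e -> (forall i, `|c 0 i| < e) -> `|c| < e.
Proof.
move=> e0 h; rewrite [ltLHS]mx_normrE; apply/bigmax_ltP; split=> // -[i j] _ /=.
by rewrite ord1.
Qed.

Lemma sum_coef_le c (b : 'I_m -> R) (B : R) : (forall i, 0 <= b i <= B) ->
  \sum_(i < m) `|c 0 i| * b i <= m%:R * B * `|c|.
Proof.
move=> hb; have -> : m%:R * B * `|c| = \sum_(i < m) `|c| * B.
  by rewrite sumr_const card_ord -mulrA mulr_natl mulrC.
apply: ler_sum => i _; have /andP[b0 bB] := hb i.
by apply: ler_pM => //; exact: rV_coef_le.
Qed.

Lemma rV_seminorm_bound g : is_seminorm g -> exists2 M, 0 < M & forall c, g c <= M * `|c|.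
Proof.
move=> sg; pose S := \sum_(i < m) g (delta_mx 0 i).
have S0 : 0 <= S by apply: sumr_ge0 => i _; exact: seminorm_ge0.
exists (S + 1) => [|c]; first by rewrite ltr_wpDl.
apply: (@le_trans _ _ (S * `|c|)); last by rewrite ler_wpM2r// lerDl.
rewrite {1}(row_sum_delta c); apply: le_trans (seminorm_bigZ sg _ _ _) _.
rewrite mulr_suml; apply: ler_sum => i _.
by rewrite mulrC ler_wpM2l ?rV_coef_le// seminorm_ge0.
Qed.

Lemma rV_seminorm_continuous g : is_seminorm g -> continuous g.
Proof.
move=> sg x; have [M M0 hM] := rV_seminorm_bound sg.
apply/(@cvgrPdist_lt _ _ _ _ (nbhs_filter x)) => e e0.
apply/nbhs_ballP; exists (e / M) => [|y]; first exact: divr_gt0.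
rewrite -ball_normE /= ltr_pdivlMr// mulrC => xy.
apply: le_lt_trans (seminorm_dist sg _ _) _.
exact: le_lt_trans (hM _) xy.
Qed.

(** On the compact unit sphere the continuous [g] attains its minimum, which is positive because [g]
    vanishes only at 0. *)
Lemma rV_norm_equiv g : is_seminorm g -> (forall c, g c = 0 -> c = 0) ->
  exists2 C, 0 < C & forall c, `|c| <= C * g c.
Proof.
move=> sg g0; pose A := [set c : 'rV[R]_m | `|c| = 1].
have cn : continuous (fun c : 'rV[R]_m => `|c|) by exact: norm_continuous.
have [A0|] := pselect (A !=set0); last first.
  (* An empty sphere means that 0 is the only vector, and then any constant works. *)
  move=> nA; exists 1 => // c; rewrite mul1r; have [->|c0] := eqVneq c 0.
    by rewrite normr0 seminorm_ge0.
  exfalso; apply: nA; exists (`|c|^-1 *: c).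
  by rewrite /A /= normrZ normfV normr_id mulVf// normr_eq0.
have cA : compact A.
  apply: bounded_closed_compact.
    by exists 1; split=> // M M1 c /= ->; exact: ltW.
  have -> : A = (fun c => `|c|) @^-1` [set 1] by [].
  by apply: preimage_closed; [move=> c _; exact: cn|exact: closed_eq].
have [|d] := @EVT_min_rV R m g A A0 cA.
  by apply: continuous_subspaceT; exact: rV_seminorm_continuous.
rewrite inE /A /= => d1 hd.
have gd : 0 < g d.
  rewrite lt_neqAle seminorm_ge0// andbT eq_sym; apply/eqP => /g0 d0.
  by move: d1; rewrite d0 normr0 => /esym/eqP; rewrite oner_eq0.
exists (g d)^-1 => [|c]; first by rewrite invr_gt0.
have [->|c0] := eqVneq c 0; first
  by rewrite normr0 mulr_ge0 ?invr_ge0 ?(seminorm_ge0 sg) ?(ltW gd).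
have nc : 0 < `|c| by rewrite normr_gt0.
have := hd (`|c|^-1 *: c); rewrite inE /A /= normrZ normfV normr_id mulVf ?gt_eqF//.
rewrite (seminormZ sg) normfV normr_id => /(_ erefl) h.
by rewrite ler_pdivlMl// mulrC -ler_pdivlMl.
Qed.

Lemma rV_rat_dense (phi : 'rV[R]_m -> R) : continuous phi ->
  (forall c : 'rV[rat]_m, 0 <= phi (map_mx ratr c)) -> forall c, 0 <= phi c.
Proof.
move=> cphi h c; rewrite leNgt; apply/negP => phic.
have /(@cvgrPdist_lt _ _ _ _ (nbhs_filter c))/(_ (- phi c)) := cphi c.
rewrite oppr_gt0 => /(_ phic)/nbhs_ballP[e /= e0 he].
have [d hd] := choice (fun i => approx_rat (c 0 i) e0).
have := he (map_mx ratr (\row_i d i)); have := h (\row_i d i).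
move=> h0 near_c; have : `|phi c - phi (map_mx ratr (\row_i d i))| < - phi c.
  by apply: near_c; rewrite -ball_normE /=; apply: rV_norm_lt => // i; rewrite !mxE.
by rewrite ltr_norml => /andP[+ _]; lra.
Qed.

End RowVectors.

(** * Weak octahedrality through rational data *)

Section Combinations.
Variables (R : realType) (E : lmodType R) (p : E -> R) (m : nat) (v : 'I_m -> E).
Hypothesis sp : is_seminorm p.

(** Used in three modules: polynomials, the reals as [R^o], and double sequences representing
    elements of the completion. *)
Definition lincomb (c : 'rV[R]_m) : E := \sum_(i < m) c 0 i *: v i.

Lemma lincombD c d : lincomb (c + d) = lincomb c + lincomb d.
Proof. by rewrite -big_split; apply: eq_bigr => i _; rewrite mxE scalerDl. Qed.

Lemma lincombZ a c : lincomb (a *: c) = a *: lincomb c.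
Proof. by rewrite scaler_sumr; apply: eq_bigr => i _; rewrite mxE scalerA. Qed.

Lemma lincombB c d : lincomb (c - d) = lincomb c - lincomb d.
Proof. by rewrite lincombD -[- d]scaleN1r lincombZ scaleN1r. Qed.

Lemma seminorm_lincomb : is_seminorm (p \o lincomb).
Proof.
split=> [c d|a c] /=; first by rewrite lincombD; exact: seminormD.
by rewrite (lincombZ a c) (seminormZ sp).
Qed.

Lemma lincombD_continuous y : continuous (fun c => p (lincomb c + y)).
Proof.
move=> c; apply/(@cvgrPdist_lt _ _ _ _ (nbhs_filter c)) => e e0.
have [M M0 hM] := rV_seminorm_bound seminorm_lincomb.
apply/nbhs_ballP; exists (e / M) => [|d]; first exact: divr_gt0.
rewrite -ball_normE /= ltr_pdivlMr// mulrC => cd.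
apply: le_lt_trans (seminorm_dist sp _ _) _.
by rewrite opprD addrACA subrr addr0 -lincombB; exact: le_lt_trans (hM _) cd.
Qed.

End Combinations.

Lemma normr_seminorm (R : realType) : is_seminorm (fun x : R^o => `|x| : R).
Proof. by split=> [x y|a x]; [exact: ler_normD|exact: normrM]. Qed.

Section Condition.
Variable R : realType.

Definition qcomb m (v : 'I_m -> {poly rat}) (c : 'rV[rat]_m) : {poly rat} :=
  \sum_(i < m) c 0 i *: v i.

Definition qval m (a : 'I_m -> rat) (c : 'rV[rat]_m) : R :=
  ratr (\sum_(i < m) c 0 i * a i).

(** A certificate that no functional in the dual ball takes the values [a] on [v]. The margin
    [1 / (d + 1)] replaces a strict inequality, to make the condition closed in [mu]. *)
Definition refuted m (v : 'I_m -> {poly rat}) (a : 'I_m -> rat) (c : 'rV[rat]_m)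
  (d : nat) (mu : V -> R) : Prop :=
  mu (polyV (qcomb v c)) + d.+1%:R^-1 <= `|qval a c|.

(** A rational vector may have no rational multiple of norm 1, so [y] is not normalised; the closed
    bound [1 / 2] keeps it away from 0, so that it can be normalised later. *)
Definition octahedral_at m (v : 'I_m -> {poly rat}) (a : 'I_m -> rat) (k : nat)
  (y : {poly rat}) (mu : V -> R) : Prop :=
  2^-1 <= mu (polyV y) /\ forall c : 'rV[rat]_m,
    (1 - k.+1%:R^-1) * (`|qval a c| + mu (polyV y)) <= mu (polyV (qcomb v c + y)).

Definition WOHq (mu : V -> R) : Prop :=
  forall m (v : 'I_m -> {poly rat}) (a : 'I_m -> rat) (k : nat),
    (exists c d, refuted v a c d mu) \/ (exists y, octahedral_at v a k y mu).

Variable mu : V -> R.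
Hypothesis smu : seminormV mu.
Let p : {poly R} -> R := pbar mu.
Let sp : is_seminorm p := pbar_seminorm smu.

Local Notation rp v := (map_poly (ratr : rat -> R) v).

Lemma rp_qcomb m (v : 'I_m -> {poly rat}) c :
  rp (qcomb v c) = lincomb (fun i => rp (v i)) (map_mx ratr c).
Proof.
rewrite /qcomb rmorph_sum; apply: eq_bigr => i _ /=; apply/polyP => j.
by rewrite coefZ !coef_map/= coefZ rmorphM mxE.
Qed.

Lemma qvalE m (a : 'I_m -> rat) c :
  qval a c = lincomb (fun i => ratr (a i) : R^o) (map_mx ratr c).
Proof.
rewrite /qval rmorph_sum; apply: eq_bigr => i _ /=.
by rewrite rmorphM mxE.
Qed.

Lemma polyV_rat (v : {poly rat}) : mu (polyV v) = p (rp v).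
Proof. by rewrite /p pbar_mu. Qed.

Lemma polyV_qcomb m (v : 'I_m -> {poly rat}) y c :
  mu (polyV (qcomb v c + y)) = p (lincomb (fun i => rp (v i)) (map_mx ratr c) + rp y).
Proof. by rewrite polyV_rat rmorphD/= rp_qcomb. Qed.

(** Both sides are continuous in [c], and rational rows are dense. With [b = 1], [t = 0], [y = 0]
    this yields the hypothesis of Hahn-Banach. *)
Lemma qcomb_real m (v : 'I_m -> {poly rat}) (a : 'I_m -> rat) (b t : R) y :
  (forall c, b * (`|qval a c| + t) <= mu (polyV (qcomb v c + y))) ->
  forall c, b * (`|lincomb (fun i => ratr (a i) : R^o) c : R| + t) <=
    p (lincomb (fun i => rp (v i)) c + rp y).
Proof.
move=> h c; rewrite -subr_ge0.
pose phi (c : 'rV[R]_m) : R := p (lincomb (fun i => rp (v i)) c + rp y) -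
  b * (`|lincomb (fun i => ratr (a i) : R^o) c : R| + t).
apply: (@rV_rat_dense _ _ phi) => [x|d]; last first.
  by rewrite /phi subr_ge0 -qvalE -polyV_qcomb.
have c1 := @lincombD_continuous _ _ _ _ (fun i => rp (v i)) sp (rp y) x.
have c2 := @rV_seminorm_continuous _ _ _
  (seminorm_lincomb (fun i => ratr (a i) : R^o) (@normr_seminorm R)) x.
have cs (z : R) : (fun=> z) @ nbhs x --> z by exact: cvg_cst.
exact: (cvgB c1 (cvgM (cs b) (cvgD c2 (cs t)))).
Qed.

Lemma WOH_WOHq : WOH mu -> WOHq mu.
Proof.
move=> woh m v a k.
(* If no rational combination violates domination, then [a] lists the values of a functional in the
   dual ball, and weak octahedrality applies to it. *)
have [[c hc]|nc] := pselect (exists c, mu (polyV (qcomb v c)) < `|qval a c|).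
  left; exists c; move: hc; rewrite -subr_gt0 => hc.
  have [d _ hd] := near_infty_natSinv_lt (PosNum hc).
  by exists d; have /ltW := hd d (leqnn d); rewrite /= lerBrDl.
right; have hq c : 1 * (`|qval a c| + 0) <= mu (polyV (qcomb v c + 0)).
  by rewrite mul1r !addr0 leNgt; apply/negP => h; apply: nc; exists c.
have {nc hq} hr := qcomb_real hq.
have [G [Glin Gp Gv]] : exists G : {poly R} -> R,
    [/\ forall s t x y, G (s *: x + t *: y) = s * G x + t * G y,
        forall x, G x <= p x & forall i, G (rp (v i)) = ratr (a i)].
  apply: hahn_banach_poly => // c; have := hr (\row_i c i).
  rewrite mul1r rmorph0 !addr0 => /(le_trans (ler_norm _)).
  rewrite /lincomb; under eq_bigr do rewrite mxE.
  by under [in leRHS]eq_bigr do rewrite mxE.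
have [f df fG] := dual_extension smu Glin Gp.
pose dl : R := k.+1%:R^-1.
have dl0 : 0 < dl by rewrite invr_gt0 ltr0n.
have dl1 : dl <= 1 by rewrite invf_le1 ?ltr0n// ler1n.
pose e (i : 'I_m) := cstX (rp (v i)).
have Xe i : isX mu (e i) by exact: isX_cst.
(* The error [dl] is split: [dl / 2] for the octahedrality of [y], and [dl / 4] twice for its
   rational replacement [y'], in the norm of [x + y] and in that of [y] alone. *)
have [|y [Xy [y1 hy]]] := woh m e Xe f df (dl / 2); first by rewrite divr_gt0.
have [|y' hy'] := xnorm_dense smu Xy (e := dl / 4); first by rewrite divr_gt0.
have Xy' := isX_cst smu (rp y').
have Xyy := isXB smu Xy Xy'.
have py1 : xnorm mu (cstX (rp y')) <= xnorm mu y + dl / 4.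
  have -> : cstX (rp y') = y + (-1) *: (y - cstX (rp y')) by rewrite scaleN1r opprB addrC subrK.
  apply: le_trans (xnormD smu Xy (isXZ smu (-1) Xyy)) _.
  by rewrite lerD2l (xnormZ smu (-1) Xyy) normrN1 mul1r ltW.
have py2 : xnorm mu y <= xnorm mu (cstX (rp y')) + dl / 4.
  rewrite -{1}(subrK (cstX (rp y')) y) addrC.
  by apply: le_trans (xnormD smu Xy' Xyy) _; rewrite lerD2l ltW.
rewrite xnorm_cst y1 -/p in py1 py2.
exists y'; split; first by rewrite polyV_rat; lra.
move=> c; rewrite polyV_qcomb polyV_rat.
set cR := map_mx ratr c : 'rV[R]_m.
pose x := \sum_(i < m) cR 0 i *: e i.
have Xx : isX mu x by exact: isX_sum.
have fx : f x = qval a c.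
  rewrite (dual_sum smu (cR 0) df Xe) qvalE /lincomb; apply: eq_bigr => i _.
  by rewrite fG Gv.
have xE : x + cstX (rp y') = cstX (lincomb (fun i => rp (v i)) cR + rp y').
  by rewrite cstXD cstX_sum.
have {}hy : (1 - dl / 2) * (`|f x| + 1) <= xnorm mu (x + y).
  by move: (hy (cR 0)); rewrite /x -sum_funE y1.
have : xnorm mu (x + y) <= p (lincomb (fun i => rp (v i)) cR + rp y') + dl / 4.
  rewrite -[p _](xnorm_cst mu) -xE -[X in x + X](subrK (cstX (rp y'))) (addrC (y - _)) addrA.
  apply: le_trans (xnormD smu (isXD smu Xx Xy') Xyy) _.
  by rewrite lerD2l ltW.
move: hy; rewrite fx -/dl.
have := normr_ge0 (qval a c); set F := `|_|; set X := xnorm mu _.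
move=> F0 h1 h2.
apply: (@le_trans _ _ ((1 - dl / 2) * (F + 1) - dl / 4)); last lra.
nra.
Qed.

End Condition.

(** Here [F = |f x|], [G] is the norm of [x], and [A], [P] are their rational counterparts. Then
    [A - P <= (2 * kap - eps / 2) * G <= 0]: shrinking [f] outweighs both approximation errors. *)
Lemma no_refutation_margin (R : realType) (eps kap F G A P i : R) :
  0 < eps -> eps <= 1 -> kap <= eps / 8 -> 0 <= G -> F <= G ->
  A <= (1 - eps / 2) * F + kap * G -> G <= P + kap * G -> P + i <= A -> i <= 0.
Proof.
move=> e0 e1 k8 G0 FG hA hP hi.
have h1 : kap * G <= eps / 8 * G by rewrite ler_wpM2r.
have h2 : (1 - eps / 2) * F <= (1 - eps / 2) * G by apply: ler_wpM2l => //; lra.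
have h3 : 0 <= eps * G by rewrite mulr_ge0// ltW.
lra.
Qed.

(** [N] is the norm of [x + y]. The errors [kap * G] grow with [x], so a large [x], with
    [G >= 2 / eps], is handled by the triangle inequality [N >= G - 1] alone; otherwise
    [kap * G <= eps / 4], and [ep < eps / 2] leaves enough room. *)
Lemma octahedral_bound (R : realType) (eps ep kap F G A P N : R) :
  0 < eps -> eps <= 1 -> 0 < ep -> ep < eps / 2 -> kap = eps * eps / 8 ->
  0 <= F -> 0 <= G -> F <= G ->
  (1 - eps / 2) * F - kap * G <= A -> (1 - ep) * (A + 1) <= P ->
  P <= N + kap * G -> G <= N + 1 -> (1 - eps) * (F + 1) <= N.
Proof.
move=> e0 e1 p0 pe kE F0 G0 FG hA hP hN hG.
case: (leP (2 / eps) G) => [|hG2].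
  rewrite ler_pdivrMr// => hG2.
  have : (1 - eps) * (F + 1) <= (1 - eps) * (G + 1) by apply: ler_wpM2l; lra.
  lra.
rewrite ltr_pdivlMr// in hG2.
have kG : kap * G <= eps / 4 by rewrite kE; nra.
have h1 : (1 - ep) * ((1 - eps / 2) * F - kap * G + 1) <= (1 - ep) * (A + 1).
  by apply: ler_wpM2l; lra.
have kG0 : 0 <= kap * G by rewrite mulr_ge0// kE divr_ge0// mulr_ge0// ltW.
have h2 : 0 <= ep * (kap * G) by rewrite mulr_ge0// ltW.
have h3 : (1 - eps) * F <= (1 - ep) * ((1 - eps / 2) * F).
  by rewrite mulrA; apply: ler_wpM2r => //; nra.
lra.
Qed.

(** * From the rational instances back to weak octahedrality *)

Section Converse.
Variables (R : realType) (mu : V -> R).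
Hypotheses (smu : seminormV mu) (wohq : WOHq mu).
Let p : {poly R} -> R := pbar mu.
Let sp : is_seminorm p := pbar_seminorm smu.

Local Notation rp v := (map_poly (ratr : rat -> R) v).

Definition octahedral_for m (e : 'I_m -> nat -> nat -> R)
    (f : (nat -> nat -> R) -> R) (eps : R) (y : nat -> nat -> R) : Prop :=
  [/\ isX mu y, xnorm mu y = 1 & forall c : 'rV[R]_m,
    (1 - eps) * (`|f (lincomb e c)| + 1) <= xnorm mu (lincomb e c + y)].

Lemma isX_lincomb m (e : 'I_m -> nat -> nat -> R) c :
  (forall i, isX mu (e i)) -> isX mu (lincomb e c).
Proof. exact: isX_sum. Qed.

Lemma xnorm_lincomb_seminorm m (e : 'I_m -> nat -> nat -> R) :
  (forall i, isX mu (e i)) -> is_seminorm (fun c : 'rV[R]_m => xnorm mu (lincomb e c)).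
Proof.
move=> Xe; split=> [c d|a c].
  by rewrite (lincombD e c d); apply: xnormD => //; exact: isX_lincomb.
by rewrite (lincombZ e a c) xnormZ//; exact: isX_lincomb.
Qed.

Lemma xnorm_le_sub s t : isX mu s -> isX mu t -> xnorm mu s <= xnorm mu t + xnorm mu (s - t).
Proof.
move=> Xs Xt; rewrite -{1}(subrK t s) [_ + t]addrC.
by apply: xnormD => //; exact: isXB.
Qed.

Lemma xnormBC s t : isX mu s -> isX mu t -> xnorm mu (s - t) = xnorm mu (t - s).
Proof.
move=> Xs Xt; rewrite -opprB -scaleN1r xnormZ ?normrN1 ?mul1r//.
exact: isXB.
Qed.

(* The rational data [(v, a)] approximate [(e, (1 - eps / 2) f e)]: shrinking [f]
   absorbs the approximation error, so that [a] is not refuted. *)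
Lemma octahedral_independent m (e : 'I_m -> nat -> nat -> R) f (eps : R) :
  (forall i, isX mu (e i)) -> (forall c, xnorm mu (lincomb e c) = 0 -> c = 0) ->
  isXdual mu f -> 0 < eps -> eps <= 1 -> exists y, octahedral_for e f eps y.
Proof.
move=> Xe ind df eps0 eps1.
pose g (c : 'rV[R]_m) := xnorm mu (lincomb e c).
have g_ge0 c : 0 <= g c by apply: xnorm_ge0 => //; exact: isX_lincomb.
have [C C0 hC] := rV_norm_equiv (xnorm_lincomb_seminorm Xe) ind.
(* [kap] is the relative error that [octahedral_bound] tolerates. Approximating vectors and values
   within [eta] costs at most [m * eta * |c|], which norm equivalence turns into [kap * g c]; the
   [+ 1] covers [m = 0]. *)
pose kap := eps * eps / 8; pose eta := kap / ((m%:R + 1) * C).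
have m1 : 0 < m%:R + 1 :> R by rewrite ltr_wpDl.
have kap0 : 0 < kap by rewrite /kap divr_gt0 ?mulr_gt0.
have eta0 : 0 < eta by rewrite /eta divr_gt0// mulr_gt0.
have etaP c : m%:R * eta * `|c| <= kap * g c.
  apply: (@le_trans _ _ ((m%:R + 1) * eta * (C * g c))).
    by apply: ler_pM => //; [rewrite mulr_ge0// ltW|rewrite ler_wpM2r ?lerDl// ltW].
  have -> : (m%:R + 1) * eta * (C * g c) = ((m%:R + 1) * C) / ((m%:R + 1) * C) * (kap * g c).
    by rewrite /eta; ring.
  by rewrite divff ?mul1r// mulf_neq0 ?gt_eqF.
have [v hv] := choice (fun i => xnorm_dense smu (Xe i) eta0).
have [a ha] := choice (fun i => approx_rat ((1 - eps / 2) * f (e i)) eta0).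
pose w c := lincomb (fun i => rp (v i)) c.
pose al c : R := lincomb (fun i => ratr (a i) : R^o) c.
have H1 c : xnorm mu (lincomb e c - cstX (w c)) <= kap * g c.
  have -> : lincomb e c - cstX (w c) = \sum_(i < m) c 0 i *: (e i - cstX (rp (v i))).
    by rewrite cstX_sum -sumrB; apply: eq_bigr => i _; rewrite scalerBr.
  have Xd i : isX mu (e i - cstX (rp (v i))) by apply: isXB => //; exact: isX_cst.
  apply: le_trans (etaP c); apply: le_trans (xnorm_sum smu _ Xd) _.
  apply: sum_coef_le => i; rewrite xnorm_ge0//=; exact: ltW.
have H2 c : `|(1 - eps / 2) * f (lincomb e c) - al c| <= kap * g c.
  have -> : (1 - eps / 2) * f (lincomb e c) - al c =
      \sum_(i < m) c 0 i * ((1 - eps / 2) * f (e i) - ratr (a i)).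
    rewrite (dual_sum smu (c 0) df Xe) mulr_sumr -sumrB; apply: eq_bigr => i _.
    by rewrite mulrBr mulrCA.
  apply: le_trans (etaP c); apply: le_trans (ler_norm_sum _ _ _) _.
  under eq_bigr do rewrite normrM.
  by apply: sum_coef_le => i; rewrite normr_ge0/=; exact: ltW.
have fg c : `|f (lincomb e c)| <= g c by apply: df.2; exact: isX_lincomb.
have Xw c : isX mu (cstX (w c)) by exact: isX_cst.
have gp c : g c <= p (w c) + kap * g c.
  rewrite -[p _](xnorm_cst mu); apply: le_trans (xnorm_le_sub _ (Xw c)) _.
    exact: isX_lincomb.
  by rewrite lerD2l.
have [k _ hk] := near_infty_natSinv_lt (PosNum (divr_gt0 eps0 (ltr0n R 2))).
have {hk} := hk k (leqnn k); rewrite /=; set ep := k.+1%:R^-1 => hk.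
have ep0 : 0 < ep by rewrite invr_gt0 ltr0n.
have kapE : kap <= eps / 8 by rewrite /kap; nra.
have norm_al c : (1 - eps / 2) * `|f (lincomb e c)| - kap * g c <= `|al c| /\
    `|al c| <= (1 - eps / 2) * `|f (lincomb e c)| + kap * g c.
  have e2 : 0 <= 1 - eps / 2 by lra.
  have := le_trans (ler_dist_dist _ _) (H2 c).
  by rewrite normrM (ger0_norm e2) ler_norml => /andP[? ?]; split; lra.
case: (wohq v a k) => [[c [d hcd]]|[y [y2 hy]]].
  exfalso; set cR := map_mx (ratr : rat -> R) c.
  have {}hcd : p (w cR) + d.+1%:R^-1 <= `|al cR|.
    by move: hcd; rewrite /refuted (polyV_rat smu) rp_qcomb qvalE.
  have d0 : 0 < d.+1%:R^-1 :> R by rewrite invr_gt0 ltr0n.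
  have [_ h] := norm_al cR.
  by have := no_refutation_margin eps0 eps1 kapE (g_ge0 cR) (fg cR) h (gp cR) hcd;
    rewrite leNgt d0.
have {}hy := qcomb_real smu hy.
rewrite (polyV_rat smu) -/p in y2 hy.
set t := p (rp y) in y2 hy.
have t0 : 0 < t by lra.
pose Y := t^-1 *: rp y.
have pY : p Y = 1 by rewrite /Y (seminormZ sp) gtr0_norm ?invr_gt0// mulVf ?gt_eqF.
have XY : isX mu (cstX Y) by exact: isX_cst.
exists (cstX Y); split=> //; first by rewrite xnorm_cst.
(* The bound at [t *: c], divided by [t], is the bound for the normalised vector [Y]. *)
have {}hy c : (1 - ep) * (`|al c| + 1) <= p (w c + Y).
  have := hy (t *: c); rewrite !lincombZ normrZ (gtr0_norm t0) -/(al c) -/(w c).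
  have -> : t *: w c + rp y = t *: (w c + Y).
    by rewrite scalerDr /Y scalerA divff ?gt_eqF// scale1r.
  rewrite -/p (seminormZ sp) (gtr0_norm t0) -{2}(mulr1 t) -mulrDr mulrCA.
  by rewrite ler_pM2l.
move=> c; have Xc := isX_lincomb c Xe.
have XcY := isXD smu Xc XY; have XwY := isXD smu (Xw c) XY.
have low1 : p (w c + Y) <= xnorm mu (lincomb e c + cstX Y) + kap * g c.
  rewrite -[p _](xnorm_cst mu) cstXD; apply: le_trans (xnorm_le_sub XwY XcY) _.
  rewrite lerD2l xnormBC// opprD addrACA subrr addr0; exact: H1.
have low2 : g c <= xnorm mu (lincomb e c + cstX Y) + 1.
  have <- : xnorm mu (cstX Y) = 1 by rewrite xnorm_cst.
  apply: le_trans (xnorm_le_sub Xc XcY) _.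
  by rewrite lerD2l xnormBC// addrAC subrr add0r.
have [hA _] := norm_al c.
exact: (octahedral_bound eps0 eps1 ep0 hk erefl (normr_ge0 _) (g_ge0 c) (fg c) hA (hy c)).
Qed.

(** Induction on the size of the family. If a combination [c] with [c_i] nonzero has norm 0, then
    [f] vanishes on it too; subtracting a multiple of it removes [e i] from any combination without
    changing norms or values of [f], so the [y] found without [e i] works. *)
Lemma octahedral_ex m (e : 'I_m -> nat -> nat -> R) f (eps : R) :
  (forall i, isX mu (e i)) -> isXdual mu f -> 0 < eps -> eps <= 1 ->
  exists y, octahedral_for e f eps y.
Proof.
elim: m e => [|m IH] e Xe df eps0 eps1.
  by apply: octahedral_independent => // c _; apply/rowP => -[].
have [ind|] := pselect (forall c, xnorm mu (lincomb e c) = 0 -> c = 0).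
  exact: octahedral_independent.
move=> /existsNP[c /not_implyP[c0 /eqP/rV0Pn[i ci]]].
have [y [Xy y1 hy]] := IH (fun j => e (lift i j)) (fun j => Xe _) df eps0 eps1.
exists y; split=> // d.
pose b := d - (d 0 i / c 0 i) *: c.
have bi : b 0 i = 0 by rewrite !mxE divfK// subrr.
have Xn := isX_lincomb c Xe; have Xb := isX_lincomb b Xe.
have dE : lincomb e d = lincomb e b + (d 0 i / c 0 i) *: lincomb e c.
  by rewrite -lincombZ -lincombD /b subrK.
have bE : lincomb e b = lincomb (fun j => e (lift i j)) (\row_j b 0 (lift i j)).
  rewrite {1}/lincomb (bigD1_ord i) //= bi scale0r add0r.
  by apply: eq_bigr => j _; rewrite mxE.
have fd : f (lincomb e d) = f (lincomb e b).
  have fc : f (lincomb e c) = 0.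
    by apply/eqP; rewrite -normr_le0 -c0; exact: df.2.
  by rewrite dE -[lincomb e b]scale1r (dual_lin _ _ df Xb Xn) fc mulr0 addr0 scale1r mul1r.
rewrite fd bE; apply: le_trans (hy _) _; rewrite -bE.
have Xd := isX_lincomb d Xe.
apply: le_trans (xnorm_le_sub (isXD smu Xb Xy) (isXD smu Xd Xy)) _.
rewrite [lincomb e b + y]addrC [lincomb e d + y]addrC opprD addrACA subrr add0r.
by rewrite xnormBC// dE addrAC subrr add0r (xnormZ smu _ Xn) c0 mulr0 addr0.
Qed.

Lemma WOHq_WOH : WOH mu.
Proof.
move=> m e Xe f df eps eps0.
(* A smaller tolerance is a stronger demand, so [eps <= 1] may be assumed. *)
have e1 : 0 < Num.min eps 1 by rewrite lt_min eps0 ltr01.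
have e2 : Num.min eps 1 <= 1 by rewrite ge_min lexx orbT.
have e3 : Num.min eps 1 <= eps by rewrite ge_min lexx.
have [y [Xy y1 hy]] := octahedral_ex Xe df e1 e2.
exists y; split=> //; split=> // c.
have := hy (\row_i c i).
have -> : lincomb e (\row_i c i) = \sum_(i < m) c i *: e i.
  by apply: eq_bigr => i _; rewrite mxE.
rewrite -sum_funE => h; rewrite y1; apply: le_trans h.
by apply: ler_wpM2r; [rewrite addr_ge0|rewrite lerD2l lerN2].
Qed.

End Converse.

(** * Borel complexity *)

Section Closed.
Variable R : realType.

Lemma closed_le_fun (T : topologicalType) (f g : T -> R) :
  continuous f -> continuous g -> closed [set x | f x <= g x].
Proof.
move=> cf cg.
have -> : [set x | f x <= g x] = (g \- f) @^-1` [set r | 0 <= r].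
  by apply/seteqP; split=> x /=; rewrite subr_ge0.
apply: preimage_closed; last exact: closed_ge.
by move=> x _; apply: cvgB; [exact: cg|exact: cf].
Qed.

Lemma closed_le_affine (T : topologicalType) (f g : T -> R) (a b : R) :
  continuous f -> continuous g -> closed [set x | a * (b + f x) <= g x].
Proof.
move=> cf cg; apply: closed_le_fun => // x.
by apply: cvgM; [exact: cvg_cst|apply: cvgD; [exact: cvg_cst|exact: cf]].
Qed.

Lemma eval_RV_continuous (u : V) : continuous (fun mu : RV R => mu u).
Proof.
move=> f; have /cvg_sup/(_ u)/cvg_image : f --> f by apply: cvg_id.
move=> h; apply: cvg_trans (h _) => {h}.
  by move=> Q /= [W nbdW <-]; apply: filterS nbdW; exact: preimage_image.
(* Evaluation at [u] is onto: changing [f] at [u] produces any value [y]. *)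
rewrite eqEsubset; split => y //= _; exists (fun v => if pselect (v = u) then y else f v) => //.
by case: pselect.
Qed.

Lemma closed_refuted m (v : 'I_m -> {poly rat}) a c d :
  closed [set mu : RV R | refuted v a c d mu].
Proof.
have := @closed_le_affine _ _ (fun=> `|qval R a c|) 1 d.+1%:R^-1
  (@eval_RV_continuous (polyV (qcomb v c))) (@cst_continuous _ _ _).
by under [X in closed X -> _]eq_set do rewrite mul1r addrC.
Qed.

Lemma closed_octahedral_at m (v : 'I_m -> {poly rat}) a k y :
  closed [set mu : RV R | octahedral_at v a k y mu].
Proof.
pose f c (mu : RV R) : R := (1 - k.+1%:R^-1) * (`|qval R a c| + mu (polyV y)).
pose g c (mu : RV R) : R := mu (polyV (qcomb v c + y)).
have -> : [set mu : RV R | octahedral_at v a k y mu] =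
    [set mu | 2^-1 <= mu (polyV y)] `&`
    \bigcap_(c in [set: 'rV[rat]_m]) [set mu | f c mu <= g c mu].
  by apply/seteqP; split=> mu [h1 h2]; split=> // c; [move=> _|]; exact: h2.
apply: closedI.
  exact: (closed_le_fun (@cst_continuous (RV R) R 2^-1) (@eval_RV_continuous _)).
apply: closed_bigI => c _.
exact: (@closed_le_affine (RV R) (fun mu => mu (polyV y)) (g c) (1 - k.+1%:R^-1) `|qval R a c|
  (@eval_RV_continuous _) (@eval_RV_continuous _)).
Qed.

Lemma Fsd_in_countable (I S : set (RV R)) (T1 : countType) (T2 : T1 -> countType)
    (D : forall t, T2 t -> set (RV R)) :
  (forall t u, closed (D t u)) ->
  S = I `&` [set mu | forall t, exists u, D t u mu] -> Fsd_in I S.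
Proof.
(* Integers that code nothing get the neutral sets: [setT] for the intersection, [set0] for the
   union. *)
move=> cD ->; exists (fun n k => if unpickle n is Some t then
  if unpickle k is Some u then D t u else set0 else setT); split=> [n k|].
  case: (unpickle n) => [t|]; last exact: closedT.
  by case: (unpickle k) => [u|]; [exact: cD|exact: closed0].
congr (_ `&` _); apply/seteqP; split=> mu h.
  move=> n _; case: (unpickle n) => [t|]; last by exists 0.
  by have [u hu] := h t; exists (pickle u) => //; rewrite pickleK.
move=> t; have [k _] := h (pickle t) Logic.I; rewrite pickleK.
by case: (unpickle k) => // u hu; exists u.
Qed.

End Closed.

Lemma WOHP (R : realType) (mu : V -> R) : seminormV mu -> WOH mu <-> WOHq mu.
Proof. by move=> smu; split; [exact: WOH_WOHq|exact: WOHq_WOH]. Qed.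

Theorem theorem6p6 (R : realType) (I : set (RV R)) :
  I = @Pinf R \/ I = @Bset R ->
  Fsd_in I (I `&` [set mu : RV R | WOH mu]).
Proof.
move=> hI; have smu mu : I mu -> seminormV mu.
  by case: hI => -> => [[]|[[]]].
(* An index in [T1] is a rational instance: vectors paired with values, and a tolerance. [T2] lists
   the witnesses of the two alternatives. *)
pose T1 : countType := ({m : nat & m.-tuple ({poly rat} * rat)} * nat)%type.
pose T2 (t : T1) : countType := ('rV[rat]_(tag t.1) * nat + {poly rat})%type.
pose v (t : T1) i := (tnth (tagged t.1) i).1.
pose a (t : T1) i := (tnth (tagged t.1) i).2.
pose D (t : T1) (u : T2 t) : set (RV R) := match u with
  | inl cd => [set mu : RV R | refuted (v t) (a t) cd.1 cd.2 mu]
  | inr y => [set mu : RV R | octahedral_at (v t) (a t) t.2 y mu] end.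
apply: (@Fsd_in_countable _ _ _ T1 T2 D).
  by move=> t [[c d]|y]; [exact: closed_refuted|exact: closed_octahedral_at].
apply/seteqP; split=> mu [Imu h]; split=> //=.
  move=> t; have hq : WOHq mu := (WOHP (smu mu Imu)).1 h.
  have [[c [d hcd]]|[y hy]] := hq _ (v t) (a t) t.2; first by exists (inl (c, d)).
  by exists (inr y).
apply/(WOHP (smu mu Imu)) => m w b k.
(* Families indexed by ordinals are recoded as tuples, which form a countable type. *)
pose t : T1 := (Tagged (fun m => m.-tuple ({poly rat} * rat)%type)
  [tuple (w i, b i) | i < m], k).
have vE : v t = w by apply/funext => i; rewrite /v /= tnth_mktuple.
have aE : a t = b by apply/funext => i; rewrite /a /= tnth_mktuple.
have [[[c d]|y] hu] := h t; [left; exists c, d|right; exists y].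
  by move: hu; rewrite /D /= vE aE.
by move: hu; rewrite /D /= vE aE.
Qed.
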